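(* Let $A, B \in \mathbb{R}^{n\times n}$ be such that the pair $(A, B)$ is diagonally Riccati stable, and let $D$, $E$ be diagonal matrices in $\mathbb{R}^{n \times n}$ with diagonal entries $d_{ii}$ and $e_{ii}$ respectively. If $0<e_{ii}^2\leq d_{ii}^2$ for $i=1,\ldots,n$, then $(DAD, DBE)$ is also diagonally Riccati stable.
   Context: $M \succ 0$ ($M \prec 0$) means that the real matrix $M=M^T$ is positive definite (negative definite). A pair $(A,B)$ of matrices in $\mathbb{R}^{n\times n}$ is diagonally Riccati stable if there exist diagonal $P \succ 0$, $Q \succ 0$ in $\mathbb{R}^{n \times n}$ with $A^TP+PA + Q + PBQ^{-1}B^TP \prec 0$. *)

(* Defs.v *)
From mathcomp Require Import all_boot all_order all_algebra.

Set Implicit Arguments.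
Unset Strict Implicit.
Unset Printing Implicit Defensive.

Import Order.TTheory GRing.Theory Num.Theory.
Local Open Scope ring_scope.

Definition posdefmx (R : realFieldType) (n : nat) (M : 'M[R]_n) : Prop :=
  M = M^T /\ forall x : 'cV[R]_n, x != 0 -> 0 < (x^T *m M *m x) 0 0.

Definition negdefmx (R : realFieldType) (n : nat) (M : 'M[R]_n) : Prop :=
  M = M^T /\ forall x : 'cV[R]_n, x != 0 -> (x^T *m M *m x) 0 0 < 0.

(* MathComp's invmx is the identity on singular matrices; here Q is positive
   definite, so invmx Q is the true inverse. *)
Definition diag_riccati_stable (R : realFieldType) (n : nat)
    (A B : 'M[R]_n) : Prop :=
  exists P Q : 'M[R]_n,
    [/\ is_diag_mx P, posdefmx P, is_diag_mx Q, posdefmx Q &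
        negdefmx (A^T *m P + P *m A + Q
                  + P *m B *m invmx Q *m B^T *m P)].

(* Main.v *)
Require Import Defs.
From mathcomp Require Import all_boot all_order all_algebra.
From mathcomp Require Import reals.

Import Order.TTheory GRing.Theory Num.Theory.
Local Open Scope ring_scope.

(** The certificate [(P, Q)] of [(A, B)] yields the certificate [(P, E Q E)]
    of [(D A D, D B E)].  Diagonal matrices commute, so the outer factors [D]
    can be pulled through [P], while the factors [E] cancel against the
    inverse of [E Q E].  Writing [S] for the Riccati expression of
    [(A, B, P, Q)], the new expression is therefore
    [D S D + (E Q E - D Q D)].
    Its first summand is negative definite because [D] is invertible
    ([negdefmx_congr]), and its second one is diagonal with entries
    [q_ii (e_ii ^ 2 - d_ii ^ 2) <= 0]. *)

Lemma quad_diag_mx (R : realFieldType) (n : nat) (d : 'rV[R]_n) (x : 'cV_n) :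
  (x^T *m diag_mx d *m x) 0 0 = \sum_i d 0 i * x i 0 ^+ 2.
Proof.
rewrite mul_mx_diag mxE; apply: eq_bigr => i _.
by rewrite !mxE mulrAC -expr2 mulrC.
Qed.

Lemma posdefmx_diag_gt0 (R : realFieldType) (n : nat) (M : 'M[R]_n) i :
  posdefmx M -> 0 < M i i.
Proof.
case=> _ /(_ (delta_mx i 0)).
rewrite trmx_delta -rowE -colE !mxE; apply.
by apply/eqP => /matrixP/(_ i 0); rewrite !mxE !eqxx => /eqP; rewrite oner_eq0.
Qed.

Lemma unitmx_diag (R : realFieldType) (n : nat) (d : 'rV[R]_n) :
  (forall i, d 0 i != 0) -> diag_mx d \in unitmx.
Proof.
by move=> d_neq0; rewrite unitmxE det_diag unitfE; apply/prodf_neq0 => i _.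
Qed.

Lemma quad_congr (R : realFieldType) (n : nat) (M T : 'M[R]_n) (x : 'cV_n) :
  x^T *m (T^T *m M *m T) *m x = (T *m x)^T *m M *m (T *m x).
Proof. by rewrite trmx_mul !mulmxA. Qed.

Lemma unitmx_mul_neq0 (R : realFieldType) (n : nat) (T : 'M[R]_n) (x : 'cV_n) :
  T \in unitmx -> x != 0 -> T *m x != 0.
Proof.
move=> uT; apply: contra_neq => Tx0.
by rewrite -[x](mulKmx uT) Tx0 mulmx0.
Qed.

Lemma posdefmx_congr (R : realFieldType) (n : nat) (M T : 'M[R]_n) :
  T \in unitmx -> posdefmx M -> posdefmx (T^T *m M *m T).
Proof.
move=> uT [symM posM]; split=> [|x x0].
  by rewrite !trmx_mul trmxK -symM mulmxA.
by rewrite quad_congr; apply/posM/unitmx_mul_neq0.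
Qed.

Lemma negdefmx_congr (R : realFieldType) (n : nat) (M T : 'M[R]_n) :
  T \in unitmx -> negdefmx M -> negdefmx (T^T *m M *m T).
Proof.
move=> uT [symM negM]; split=> [|x x0].
  by rewrite !trmx_mul trmxK -symM mulmxA.
by rewrite quad_congr; apply/negM/unitmx_mul_neq0.
Qed.

Lemma negdefmxD_diag (R : realFieldType) (n : nat) (M : 'M[R]_n) (d : 'rV_n) :
  (forall i, d 0 i <= 0) -> negdefmx M -> negdefmx (M + diag_mx d).
Proof.
move=> d_le0 [symM negM]; split=> [|x x0].
  by rewrite linearD /= tr_diag_mx -symM.
rewrite mulmxDr mulmxDl mxE quad_diag_mx -[ltRHS]addr0.
apply: ltr_leD; first exact: negM.
by apply: sumr_le0 => i _; rewrite mulr_le0_ge0 ?sqr_ge0.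
Qed.

Lemma invmx_mul (R : comUnitRingType) (n : nat) (M N : 'M[R]_n) :
  M \in unitmx -> N \in unitmx -> invmx (M *m N) = invmx N *m invmx M.
Proof.
move=> uM uN; have uMN : M *m N \in unitmx by rewrite unitmx_mul uM.
apply: (can_inj (mulKmx uMN)).
by rewrite mulmxV // mulmxA mulmxK // mulmxV.
Qed.

(** The terms in [A] and [B] are congruent by [D] to the old ones: [P] commutes
    with [D], and [E (E Q E)^-1 E = Q^-1].  The term [Q] becomes [E Q E] instead
    of [D Q D], which accounts for the correction. *)
Lemma riccati_congr (R : realFieldType) (n : nat) (A B P Q D E : 'M[R]_n) :
    D^T = D -> E^T = E -> P *m D = D *m P -> E \in unitmx -> Q \in unitmx ->
  (D *m A *m D)^T *m P + P *m (D *m A *m D) + E *m Q *m E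
    + P *m (D *m B *m E) *m invmx (E *m Q *m E) *m (D *m B *m E)^T *m P
  = D *m (A^T *m P + P *m A + Q + P *m B *m invmx Q *m B^T *m P) *m D
    + (E *m Q *m E - D *m Q *m D).
Proof.
move=> symD symE PD uE uQ.
have invEQE : invmx (E *m Q *m E) = invmx E *m invmx Q *m invmx E.
  by rewrite !invmx_mul ?unitmx_mul ?uE ?uQ // mulmxA.
have tA : (D *m A *m D)^T *m P = D *m (A^T *m P) *m D.
  by rewrite !trmx_mul symD -!mulmxA PD.
have tB : P *m (D *m B *m E) *m invmx (E *m Q *m E) *m (D *m B *m E)^T *m P
          = D *m (P *m B *m invmx Q *m B^T *m P) *m D.
  rewrite invEQE !trmx_mul symD symE !mulmxA PD mulmxK // mulmxKV //.
  by rewrite -!mulmxA PD.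
rewrite tA tB !mulmxA PD !mulmxDr !mulmxDl !mulmxA.
rewrite -!addrA; do 2 congr (_ + _).
by rewrite [RHS]addrCA (addrC _ (_ - _)) subrK addrC.
Qed.

Theorem proposition3p1 (R : realType) (n : nat) (A B D E : 'M[R]_n)
    (hAB : diag_riccati_stable A B)
    (hD : is_diag_mx D) (hE : is_diag_mx E)
    (hDE : forall i : 'I_n, 0 < E i i ^+ 2 <= D i i ^+ 2) :
  diag_riccati_stable (D *m A *m D) (D *m B *m E).
Proof.
have [P [Q [dP posP dQ posQ negS]]] := hAB.
have [p Pp] := diag_mxP _ dP; have [q Qq] := diag_mxP _ dQ.
have [d Dd] := diag_mxP _ hD; have [e Ee] := diag_mxP _ hE.
have q_gt0 i : 0 < q 0 i.
  by have := posdefmx_diag_gt0 _ _ _ i posQ; rewrite Qq mxE eqxx.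
have ed i : 0 < e 0 i ^+ 2 <= d 0 i ^+ 2.
  by have := hDE i; rewrite Dd Ee !mxE eqxx.
have uE : E \in unitmx.
  rewrite Ee; apply: unitmx_diag => i; have /andP[] := ed i.
  by rewrite lt0r sqrf_eq0 => /andP[].
have uD : D \in unitmx.
  rewrite Dd; apply: unitmx_diag => i; have /andP[e0 /(lt_le_trans e0)] := ed i.
  by rewrite lt0r sqrf_eq0 => /andP[].
have uQ : Q \in unitmx.
  by rewrite Qq; apply: unitmx_diag => i; rewrite gt_eqF.
have symD : D^T = D by rewrite Dd tr_diag_mx.
have symE : E^T = E by rewrite Ee tr_diag_mx.
have PD : P *m D = D *m P by rewrite Pp Dd diag_mxC.
exists P, (E *m Q *m E); split=> //.
- by rewrite Ee Qq !mulmx_diag diag_mx_is_diag.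
- by rewrite -{1}symE; apply: posdefmx_congr.
rewrite riccati_congr //.
have -> : E *m Q *m E - D *m Q *m D
          = diag_mx (\row_i (q 0 i * (e 0 i ^+ 2 - d 0 i ^+ 2))).
  rewrite Ee Qq Dd !mulmx_diag -linearB /=; congr diag_mx.
  by apply/rowP => i; rewrite !mxE mulrBr !expr2 !mulrA ![_ * q 0 i]mulrC.
apply: negdefmxD_diag => [i|]; last by rewrite -{1}symD; apply: negdefmx_congr.
have /andP[_ le_ed] := ed i.
by rewrite mxE pmulr_rle0 // subr_le0.
Qed.
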